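(* Let $n\ge 2$ and $g\ge 0$ be integers with $2g-2+n>0$. For every connected graph $G\in\mathcal F_{g,n}$, $$\lambda_1(G)\le\sigma_1(G)\le\frac{16(g+1)}{3n}.$$
   Context: Graphs are finite; multiple edges are allowed, and loops are allowed at degree-$3$ vertices; a loop contributes $2$ to the degree of its vertex. For non-negative integers $g,n$ with $2g-2+n>0$, $\mathcal F_{g,n}$ is the set of connected graphs $G$ with a decomposition $V(G)=V'(G)\sqcup\delta G$ such that $|V'(G)|=2g-2+n$, $|\delta G|=n$, every vertex of $V'(G)$ has degree $3$ and every vertex of $\delta G$ has degree $1$. The vertices of $\delta G$ are called boundary vertices. Graph Laplacian: for $f:V(G)\to\mathbb R$, $\Delta_Gf(v)=\frac1{\deg(v)}\sum_{w\sim v}(f(w)-f(v))$, the sum being over edges joining $v$ to $w$ (counted with multiplicity; loops contribute $0$). The eigenvalues of $-\Delta_G$, counted with multiplicity, are $0=\lambda_0(G)<\lambda_1(G)\le\lambda_2(G)\le\cdots\le 2$. Steklov problem: for $x\in\delta G$ with unique neighbour $y$, put $\frac{\partial f}{\partial\vec n}(x)=f(x)-f(y)$. A number $\sigma\in\mathbb R$ is a Steklov eigenvalue of $(G,\delta G)$ if there is a nonzero $f:V(G)\to\mathbb R$ with $\Delta_Gf(x)=0$ for all $x\in V(G)\setminus\delta G$ and $\frac{\partial f}{\partial\vec n}(x)=\sigma f(x)$ for all $x\in\delta G$. There are $|\delta G|$ Steklov eigenvalues counted with multiplicity, $0=\sigma_0(G)<\sigma_1(G)\le\cdots\le\sigma_{|\delta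 G|-1}(G)\le 1$. Equivalently, $\sigma_1(G)$ is the minimum of $\sum_{\{x,y\}\in E(G)}(f(x)-f(y))^2\big/\sum_{x\in\delta G}f(x)^2$ over all $f:V(G)\to\mathbb R$ with $f|_{\delta G}\not\equiv0$ and $\sum_{x\in\delta G}f(x)=0$. *)

(* Defs.v *)
From HB Require Import structures.
From mathcomp Require Import all_boot all_order all_algebra.
From mathcomp Require Import boolp classical_sets reals.
From mathcomp Require Import polyrcf ring zify.
Set Implicit Arguments.
Unset Strict Implicit.
Unset Printing Implicit Defensive.
Import Order.TTheory GRing.Theory Num.Theory.
Local Open Scope ring_scope.

(* A finite multigraph, possibly with loops, with a distinguished set [bdry]
   of vertices. Edges are undirected: [src e] and [tgt e] are the two ends of
   [e] in an arbitrary order, and nothing below depends on that order. *)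
Record bgraph := BGraph {
  vertex : finType;
  edge : finType;
  src : edge -> vertex;
  tgt : edge -> vertex;
  bdry : {set vertex}
}.

Section Graph.
Variable G : bgraph.
Implicit Types (x y v : vertex G) (e : edge G).

Definition adj x y : bool :=
  [exists e : edge G, ((src e == x) && (tgt e == y))
                   || ((src e == y) && (tgt e == x))].

(* A loop is counted once by each term, hence contributes 2. *)
Definition deg v : nat :=
  (#|[set e : edge G | src e == v]| + #|[set e : edge G | tgt e == v]|)%N.

Definition connected_graph : Prop := forall x y, connect adj x y.

(* At a boundary vertex of degree 1 this is its unique neighbour. *)
Definition nbr x : vertex G := odflt x [pick y | adj x y].

End Graph.

(* The class F_{g,n}; it is only considered for 2g - 2 + n > 0, so the
   subtraction is never truncated. *)
Definition in_F (g n : nat) (G : bgraph) : Prop :=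
  [/\ connected_graph G,
      #|~: bdry G| = (2 * g + n - 2)%N,
      #|bdry G| = n,
      forall v : vertex G, v \notin bdry G -> deg v = 3%N
    & forall v : vertex G, v \in bdry G -> deg v = 1%N].

Section Spectrum.
Variable R : realType.

(* [s] lists in nondecreasing order the x such that [mult x > 0], each of them
   [mult x] times; there is at most one such list. *)
Definition lists_spectrum (mult : R -> nat) (s : seq R) : Prop :=
  sorted <=%R s /\ forall x, count_mem x s = mult x.

Definition spectrum (mult : R -> nat) : seq R :=
  xget [::] [set s | lists_spectrum mult s].

Variable G : bgraph.

(* [R^o] is [R] seen as a vector space over itself. *)
Local Notation fT := {ffun vertex G -> R^o}.
Implicit Types (f : fT) (v x : vertex G).

Definition laplacian f : fT :=
  [ffun v => (deg v)%:R^-1 *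
     (\sum_(e : edge G | src e == v) (f (tgt e) - f v)
      + \sum_(e : edge G | tgt e == v) (f (src e) - f v))].

Definition normal_deriv f x : R := f x - f (nbr x).

Lemma laplacian_is_linear : linear laplacian.
Proof.
move=> a f h; apply/ffunP => v; rewrite !ffunE.
have E (t : edge G -> vertex G) (P : pred (edge G)) :
    \sum_(e : edge G | P e) ((a *: f + h) (t e) - (a *: f v + h v))
    = a * \sum_(e | P e) (f (t e) - f v) + \sum_(e | P e) (h (t e) - h v).
  rewrite mulr_sumr -big_split /=; apply: eq_bigr => e _.
  by rewrite !ffunE /GRing.scale /=; ring.
by rewrite !E /GRing.scale /=; ring.
Qed.
HB.instance Definition _ := GRing.isLinear.Build R fT fT _ laplacian
  laplacian_is_linear.

Definition laplace_mult (x : R) : nat :=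
  \dim (passmx.leigenspace (- linfun laplacian) x).

(* Its kernel is the space of solutions of the Steklov problem with parameter
   [sigma], see [mem_steklov_space]. *)
Definition steklov_op (sigma : R) f : fT :=
  [ffun v => if v \in bdry G then normal_deriv f v - sigma * f v
             else laplacian f v].

Lemma steklov_op_is_linear sigma : linear (steklov_op sigma).
Proof.
move=> a f h; apply/ffunP => v; rewrite /steklov_op [LHS]ffunE [RHS]ffunE.
rewrite [in RHS]ffunE [X in _ = _ + X]ffunE [X in _ = _ *: X + _]ffunE.
case: ifP => _; last by rewrite linearP [LHS]ffunE [X in X + _]ffunE.
by rewrite /normal_deriv !ffunE /GRing.scale /=; ring.
Qed.
HB.instance Definition _ sigma := GRing.isLinear.Build R fT fT _
  (steklov_op sigma) (steklov_op_is_linear sigma).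

Definition steklov_space (sigma : R) : {vspace fT} :=
  lker (linfun (steklov_op sigma)).

Definition steklov_mult (sigma : R) : nat := \dim (steklov_space sigma).

Definition laplace_spectrum : seq R := spectrum laplace_mult.
Definition steklov_spectrum : seq R := spectrum steklov_mult.

Lemma mem_laplace_space (a : R) f :
  reflect (forall v, - laplacian f v = a * f v)
          (f \in passmx.leigenspace (- linfun laplacian) a).
Proof.
rewrite memv_ker add_lfunE !opp_lfunE scale_lfunE id_lfunE lfunE /= subr_eq0.
by apply: (iffP eqP) => [/ffunP E v | E]; [have := E v | apply/ffunP => v;
  have := E v]; rewrite !ffunE.
Qed.

Lemma mem_steklov_space (sigma : R) f :
  reflect ((forall v, v \notin bdry G -> laplacian f v = 0) /\
           (forall x, x \in bdry G -> normal_deriv f x = sigma * f x))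
          (f \in steklov_space sigma).
Proof.
rewrite memv_ker lfunE /=; apply: (iffP eqP) => [/ffunP E | [E0 E1]].
  split=> v hv; have := E v; rewrite /steklov_op [LHS]ffunE [RHS]ffunE.
    by rewrite (negbTE hv).
  by rewrite hv => /eqP; rewrite subr_eq0 => /eqP.
apply/ffunP => v; rewrite /steklov_op [LHS]ffunE [RHS]ffunE.
by case: ifPn => [/E1 ->|/E0 //]; rewrite subrr.
Qed.

End Spectrum.

(* The lists of eigenvalues exist, so the default value in [spectrum] is never
   reached on the graphs considered. *)
Section Existence.
Variable R : realType.

Lemma lists_spectrum_ex (mult : R -> nat) (s0 : seq R) :
  (forall x, mult x != 0%N -> x \in s0) -> exists s, lists_spectrum mult s.
Proof.
move=> hs; pose t := flatten [seq nseq (mult x) x | x <- undup s0].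
exists (sort <=%R t); split; first exact: (sort_sorted (@le_total _ R)).
move=> x; have /permP -> : perm_eq (sort <=%R t) t by rewrite perm_sort.
have -> : count_mem x t = (count_mem x (undup s0) * mult x)%N.
  rewrite /t; elim: (undup s0) => //= y r IH.
  rewrite count_cat IH count_nseq mulnDl; congr (_ + _)%N.
  by rewrite /=; case: eqP => [->|_]; rewrite ?mul1n ?mul0n.
rewrite count_uniq_mem ?undup_uniq // mem_undup.
by case: (eqVneq (mult x) 0%N) => [->|/hs ->]; rewrite ?muln0 ?mul1n.
Qed.

Lemma lists_spectrum_uniq (mult : R -> nat) (s t : seq R) :
  lists_spectrum mult s -> lists_spectrum mult t -> s = t.
Proof.
move=> [ss hs] [st ht]; apply: (@sorted_eq _ <=%R) => //.
- exact: le_trans.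
- exact: le_anti.
by apply/allP => x _ /=; rewrite hs ht.
Qed.

Import VectorInternalTheory.
Lemma pencil_finite (vT : vectType R) (A B : 'End(vT)) :
  (forall u, A u + B u = 0 -> u = 0) ->
  exists s : seq R, forall a u, u != 0 -> A u = a *: B u -> a \in s.
Proof.
move=> injAB.
have kAB : lker (A + B)%R == 0%VS.
  by apply/lker0P => u v /eqP; rewrite -subr_eq0 -linearB /= add_lfunE =>
    /eqP /injAB /eqP; rewrite subr_eq0 => /eqP.
pose D := ((A + B)^-1 \o B)%VF.
pose p := char_poly (f2mx D).
exists [seq x^-1 - 1 | x <- rootsR p] => a u u0 Au.
have Du : u = (a + 1) *: D u.
  rewrite /D comp_lfunE -linearZ /= scalerDl scale1r -Au -add_lfunE.
  by rewrite lker0_lfunK.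
have a1 : a + 1 != 0.
  by apply: contraNneq u0 => a10; rewrite Du a10 scale0r.
apply/mapP; exists (a + 1)^-1; last by rewrite invrK addrK.
have p0 : p != 0 by rewrite monic_neq0 // char_poly_monic.
rewrite -(roots_on_rootsR p0) in_itv /= -eigenvalue_root_char.
apply/eigenvalueP; exists (v2r u).
  apply: (can_inj (@r2vK _ vT)); rewrite linearZ /= v2rK.
  have -> : r2v (v2r u *m f2mx D) = D u by rewrite unlock.
  by rewrite [in RHS]Du scalerA mulVf // scale1r.
by apply: contraNneq u0 => v0; rewrite -(v2rK u) v0 linear0.
Qed.

Variable G : bgraph.
Local Notation fT := {ffun vertex G -> R^o}.
Implicit Types (f : fT) (v x : vertex G).

Let L f v : R :=
  \sum_(e : edge G | src e == v) (f (tgt e) - f v)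
  + \sum_(e : edge G | tgt e == v) (f (src e) - f v).

Lemma green f :
  \sum_v f v * L f v = - \sum_(e : edge G) (f (src e) - f (tgt e)) ^+ 2.
Proof.
have E (r t : edge G -> vertex G) :
    \sum_v f v * \sum_(e | r e == v) (f (t e) - f v)
    = \sum_e f (r e) * (f (t e) - f (r e)).
  rewrite [RHS](partition_big r xpredT) //=; apply: eq_bigr => v _.
  by rewrite mulr_sumr; apply: eq_bigr => e /eqP ->.
under eq_bigr do rewrite mulrDr.
rewrite big_split /= !E -big_split -sumrN /=.
by apply: eq_bigr => e _; ring.
Qed.

Lemma energy_const f : connected_graph G ->
  \sum_(e : edge G) (f (src e) - f (tgt e)) ^+ 2 = 0 ->
  forall x y, f x = f y.
Proof.
move=> cG; move/eqP; rewrite psumr_eq0; last by move=> *; apply: sqr_ge0.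
move=> /allP fe; have {}fe e : f (src e) = f (tgt e).
  have /= := fe e (mem_index_enum _).
  by rewrite sqrf_eq0 subr_eq0 => /eqP.
move=> x y; have /connectP[p + ->] := cG x y.
elim: p x => //= z p IH x /andP[/existsP[e he] /IH <-].
by case/orP: he => /andP[/eqP <- /eqP <-]; rewrite fe.
Qed.

Lemma deg1_normal_deriv f x : deg x = 1%N -> normal_deriv f x = - L f x.
Proof.
rewrite /deg /normal_deriv /nbr /L.
set S := [set _ | _]; set T := [set _ | _] => dx.
have eS e : (src e == x) = (e \in S) by rewrite inE.
have eT e : (tgt e == x) = (e \in T) by rewrite inE.
rewrite (eq_bigl _ _ eS) (eq_bigl _ _ eT) {eS eT}.
have [[S1 T0]|[S0 T1]] : (#|S| = 1 /\ #|T| = 0)%N \/ (#|S| = 0 /\ #|T| = 1)%N.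
- by lia.
- have /cards1P[e Se] : #|S| == 1%N by apply/eqP.
  have Te : T = finset.set0 by apply: finset.cards0_eq.
  have se e' : (src e' == x) = (e' == e) by rewrite -(finset.in_set1 e' e) -Se inE.
  have te e' : (tgt e' == x) = false by rewrite -[RHS](finset.in_set0 e') -Te inE.
  rewrite Se Te big_set0 big_set1 addr0 opprB; congr (_ - f _).
  case: pickP => [y /existsP[e' /orP[]/andP[h1 h2]] | /(_ (tgt e))].
  + by move: h1; rewrite se => /eqP ee; rewrite -(eqP h2) ee.
  + by move: h2; rewrite te.
  + by move/existsP => []; exists e; rewrite se !eqxx.
have /cards1P[e Te] : #|T| == 1%N by apply/eqP.
have Se : S = finset.set0 by apply: finset.cards0_eq.
have te e' : (tgt e' == x) = (e' == e) by rewrite -(finset.in_set1 e' e) -Te inE.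
have se e' : (src e' == x) = false by rewrite -[RHS](finset.in_set0 e') -Se inE.
rewrite Se Te big_set0 big_set1 add0r opprB; congr (_ - f _).
case: pickP => [y /existsP[e' /orP[]/andP[h1 h2]] | /(_ (src e))].
+ by move: h1; rewrite se.
+ by move: h2; rewrite te => /eqP ee; rewrite -(eqP h1) ee.
+ by move/existsP => []; exists e; rewrite te !eqxx orbT.
Qed.

Lemma deg_laplacian f v : (0 < deg v)%N -> (deg v)%:R * laplacian f v = L f v.
Proof. by move=> dv; rewrite ffunE mulVKf // pnatr_eq0 -lt0n. Qed.

Lemma laplace_spectrumP : (forall v : vertex G, 0 < deg v)%N ->
  lists_spectrum (@laplace_mult R G) (laplace_spectrum R G).
Proof.
move=> dG.
suff [s hs] : exists s, lists_spectrum (@laplace_mult R G) s.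
  by rewrite /laplace_spectrum /spectrum; case: xgetP => // /(_ s).
have [|s hs] := @pencil_finite fT (- linfun (@laplacian R G)) \1%VF.
  move=> f; rewrite opp_lfunE id_lfunE lfunE /= => /ffunP Hf.
  have : \sum_v f v * L f v = \sum_v (deg v)%:R * f v ^+ 2.
    apply: eq_bigr => v _; rewrite -deg_laplacian //.
    have /eqP := Hf v; rewrite !ffunE addrC subr_eq0 => /eqP <-.
    by rewrite [in RHS]expr2 mulrCA.
  rewrite green => En.
  have pos v : 0 <= (deg v)%:R * f v ^+ 2 by rewrite mulr_ge0 ?sqr_ge0.
  have /eqP : \sum_v (deg v)%:R * f v ^+ 2 = 0.
    apply/eqP; rewrite eq_le sumr_ge0 // andbT -En oppr_le0.
    by apply: sumr_ge0 => *; apply: sqr_ge0.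
  rewrite psumr_eq0 // => /allP H; apply/ffunP => v; rewrite ffunE.
  have /= := H v (mem_index_enum _).
  by rewrite mulf_eq0 pnatr_eq0 eqn0Ngt dG /= sqrf_eq0 => /eqP.
apply: (@lists_spectrum_ex _ s) => a; rewrite /laplace_mult dimv_eq0 => E.
apply: (hs a (vpick (passmx.leigenspace (- linfun (@laplacian R G)) a))).
  by rewrite vpick0.
have := memv_pick (passmx.leigenspace (- linfun (@laplacian R G)) a).
by rewrite memv_ker add_lfunE [X in _ + X]opp_lfunE subr_eq0 scale_lfunE => /eqP.
Qed.

Lemma steklov_spectrumP : connected_graph G -> bdry G != finset.set0 ->
  (forall v : vertex G, 0 < deg v)%N ->
  (forall v : vertex G, v \in bdry G -> deg v = 1%N) ->
  lists_spectrum (@steklov_mult R G) (steklov_spectrum R G).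
Proof.
move=> cG /set0Pn[x0 x0B] dG d1.
suff [s hs] : exists s, lists_spectrum (@steklov_mult R G) s.
  by rewrite /steklov_spectrum /spectrum; case: xgetP => // /(_ s).
pose A := linfun (@steklov_op R G 0).
pose B := A - linfun (@steklov_op R G 1).
have AB a f : linfun (steklov_op a) f = A f - a *: B f.
  rewrite /B add_lfunE opp_lfunE !lfunE /=; apply/ffunP => v.
  rewrite [LHS]ffunE [RHS]ffunE /steklov_op !ffunE /GRing.scale /=.
  by case: ifP => _; ring.
have [|s hs] := @pencil_finite fT A B.
  move=> f; rewrite -[B f]scale1r -[X in _ + X]opprK -scaleNr -AB lfunE /=.
  move=> /ffunP Hf.
  have HL v : L f v = if v \in bdry G then f v else 0.
    have := Hf v; rewrite /steklov_op [LHS]ffunE [RHS]ffunE; case: ifP => vB.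
      rewrite deg1_normal_deriv ?d1 // mulN1r opprK addrC => /eqP.
      by rewrite subr_eq0 => /eqP.
    by rewrite -deg_laplacian // => ->; rewrite mulr0.
  have := green f; under eq_bigr do rewrite HL.
  have pos v : 0 <= f v * (if v \in bdry G then f v else 0).
    by case: ifP; rewrite ?mulr0 // -expr2 sqr_ge0.
  set W := \sum_(e : edge G) _ => En.
  have W0 : 0 <= W by apply: sumr_ge0 => *; apply: sqr_ge0.
  have S0 : 0 <= \sum_v f v * (if v \in bdry G then f v else 0) by exact: sumr_ge0.
  have We : W = 0.
    by apply/eqP; rewrite eq_le W0 andbT -oppr_ge0 -En.
  move/eqP: En; rewrite We oppr0 psumr_eq0 // => /allP /(_ x0).
  rewrite mem_index_enum x0B mulf_eq0 orbb => /(_ isT) /eqP fx0.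
  by apply/ffunP => v; rewrite (energy_const cG We v x0) fx0 ffunE.
apply: (@lists_spectrum_ex _ s) => a; rewrite /steklov_mult dimv_eq0 => E.
apply: (hs a (vpick (steklov_space G a))); first by rewrite vpick0.
have := memv_pick (steklov_space G a).
by rewrite memv_ker AB subr_eq0 => /eqP.
Qed.

End Existence.

(* Main.v *)
Require Import Defs.
From mathcomp Require Import classical_sets.
From mathcomp Require Import all_boot all_order all_algebra reals.
From mathcomp Require Import topology normedtype derive.
From mathcomp Require Import zify ring lra.
Set Implicit Arguments.
Unset Strict Implicit.
Unset Printing Implicit Defensive.
Import Order.TTheory GRing.Theory Num.Theory numFieldNormedType.Exports.

(** Both eigenvalues are instances of one variational problem. For a weight
    [w] on the vertices, put [mass f = sum_v w v * f v ^ 2] and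
    [mean f = sum_v w v * f v], and let [energy f] be the Dirichlet energy.
    The critical points of [energy] on [mass f = 1] are the solutions of
    [- flux f v = a * w v * f v]: the Laplace eigenfunctions for [w = deg], the
    Steklov eigenfunctions when [w] is the indicator of the boundary. On a
    connected graph [0] is a simple eigenvalue with the constants as
    eigenfunctions, hence the second eigenvalue of the sorted list is the
    minimum of [energy f / mass f] over [mean f = 0]
    ([second_eigenvalue_le], [second_eigenvalue_attained]). The minimum exists
    by compactness ([rayleigh_min]), although [mass] may vanish on interior
    vertices: truncating a function of mass [1] to [[-1, 1]] does not raise its
    energy and leaves the vertices of positive weight alone ([truncate]).

    For the first inequality, take a Steklov eigenfunction [f] for the
    eigenvalue [s] and subtract its [deg]-mean. The energy is unchanged, and the
    [deg]-mass of the result is at least its boundary mass, which is at least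
    the boundary mass of [f] because [f] has boundary mean [0]. So the result
    has Laplace Rayleigh quotient at most [s].

    For the second one, choose a spanning tree and in it an edge that splits
    the [n] boundary vertices into parts of sizes [a, b >= n / 3]; such an edge
    exists as the tree has maximal degree [3]. As [G] has [g] edges outside the
    tree, at most [g + 1] edges join the two sides ([balanced_cut]). The
    function equal to [b] on one side and [- a] on the other has boundary mean
    [0], energy at most [(g + 1) * n ^ 2] and boundary mass [a * b * n], so its
    quotient is at most [(g + 1) * n / (a * b)]; and
    [(3 * a - n) * (3 * b - n) >= 0] gives [9 * a * b >= 2 * n ^ 2], which is
    stronger than the [16 * a * b >= 3 * n ^ 2] that the bound requires. *)

(** * Balanced cuts from a spanning tree *)

Definition incident G (e : edge G) v := (src e == v) || (tgt e == v).

Definition opp_end G (e : edge G) v := if src e == v then tgt e else src e.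

Definition crosses G (A : {set vertex G}) (e : edge G) :=
  (src e \in A) != (tgt e \in A).

Lemma handshake G : \sum_(v : vertex G) deg v = 2 * #|edge G|.
Proof.
have H (r : edge G -> vertex G) :
    \sum_v #|[set e : edge G | r e == v]| = #|edge G|.
  rewrite -[RHS]sum1_card (partition_big r xpredT) //=.
  by apply: eq_bigr => v _; rewrite -sum1_card; apply: eq_bigl => e; rewrite inE.
by rewrite big_split /= !H mul2n addnn.
Qed.

Lemma card_incident G (v : vertex G) : #|[set e | incident e v]| <= deg v.
Proof.
rewrite (_ : [set e | _] = [set e | src e == v] :|: [set e | tgt e == v]).
  by rewrite cardsU leq_subr.
by apply/setP => e; rewrite !inE.
Qed.

Lemma opp_end_eq G (e : edge G) u v :
  incident e u -> incident e v -> u != v -> opp_end e u = v.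
Proof.
rewrite /incident /opp_end => /orP[]/eqP su /orP[]/eqP sv; subst => //.
- by rewrite eqxx.
- by rewrite eqxx.
- by move/negPf; rewrite eq_sym => ->.
- by rewrite eqxx.
Qed.

(** Breadth-first search: every vertex other than the root has an edge towards
    a neighbour closer to the root. Choosing one such edge per vertex gives a
    spanning tree. *)
Lemma dist_exists G (r : vertex G) : connected_graph G ->
  exists d : vertex G -> nat, forall v, v != r ->
    exists e, incident e v && (d (opp_end e v) < d v).
Proof.
move=> cG.
have wP v : exists k, [exists p : k.-tuple (vertex G),
    path (@adj G) r p && (last r p == v)].
  have /connectP[p pp ->] := cG r v; exists (size p).
  by apply/existsP; exists (in_tuple p); rewrite /= pp eqxx.
pose d v := ex_minn (wP v).
exists d => v vr.
have [k [q [pq aqv sq dv]]] : exists k (q : seq (vertex G)), [/\ path (@adj G) r q,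
    adj (last r q) v, size q = k & d v = k.+1].
  rewrite /d; case: ex_minnP => k /existsP[[p /= /eqP sp]] /andP[pp /eqP lp] _.
  case/lastP: p pp lp sp => [|q z]; first by move=> _ /esym/eqP; rewrite (negPf vr).
  rewrite rcons_path last_rcons size_rcons => /andP[pq az] zv sz.
  by exists (size q), q; rewrite -zv; split.
have du : d (last r q) <= k.
  rewrite {1}/d; case: ex_minnP => m _; apply; apply/existsP.
  by rewrite -sq; exists (in_tuple q); rewrite /= pq eqxx.
case/existsP: aqv => e he; exists e; rewrite /incident /opp_end dv ltnS.
by case/orP: he => /andP[/eqP h1 /eqP h2]; rewrite h1 h2 ?eqxx ?orbT //=;
   case: eqP => // <-.
Qed.

Section Descendants.
Variables (G : bgraph) (r : vertex G) (d : vertex G -> nat).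
Variable pe : vertex G -> edge G.
Hypothesis peP : forall v, v != r ->
  incident (pe v) v && (d (opp_end (pe v) v) < d v).
Implicit Types (u v : vertex G) (e : edge G).

Definition parent v := if v == r then r else opp_end (pe v) v.

Definition desc v := [set u | fconnect parent u v].

Definition children v := [set c | (c != r) && (parent c == v)].

Lemma ltn_parent v : v != r -> d (parent v) < d v.
Proof. by move=> vr; have := peP vr; rewrite /parent (negPf vr) => /andP[]. Qed.

(** If two vertices had the same parent edge, each would be the parent of the
    other, and so strictly closer to the root. *)
Lemma pe_inj : {in [set~ r] &, injective pe}.
Proof.
move=> u v; rewrite !inE => ur vr E; apply/eqP; apply: contraT => uv.
have /andP[iu du] := peP ur; have /andP[iv dv] := peP vr.
rewrite -E in iv dv.
rewrite (opp_end_eq iu iv uv) in du; rewrite eq_sym in uv.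
by rewrite (opp_end_eq iv iu uv) in dv; lia.
Qed.

Lemma desc_root : desc r = setT.
Proof.
apply/setP => u; rewrite !inE; have [m] := ubnP (d u); elim: m u => // m IH u du.
have [-> | ur] := eqVneq u r; first exact: connect0.
apply: connect_trans (fconnect1 _ _) (IH (parent u) _).
exact: leq_trans (ltn_parent ur) du.
Qed.

Lemma desc_parent u v : u != v -> (parent u \in desc v) = (u \in desc v).
Proof.
rewrite !inE => uv; apply/idP/idP => [|/iter_findex].
  exact: connect_trans (fconnect1 _ _).
case: (findex parent u v) => [/eqP|k]; first by rewrite (negPf uv).
by rewrite iterSr => <-; apply: fconnect_iter.
Qed.

(** Both ends of any other tree edge are descendants of [v], or neither is. *)
Lemma crosses_desc u v : u != r -> crosses (desc v) (pe u) -> u = v.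
Proof.
move=> ur; apply: contraTeq => /desc_parent; rewrite /parent (negPf ur) /crosses.
have /andP[+ _] := peP ur; rewrite /incident /opp_end.
by case: eqP => [-> _ ->|_ /eqP -> ->]; rewrite eqxx.
Qed.

(** Besides the parent edge of [v], only edges outside the tree can cross, and
    there are [#|edge G| - (#|vertex G| - 1)] of them. *)
Lemma card_crosses_desc v :
  #|[set e | crosses (desc v) e]| + #|vertex G| <= #|edge G| + 2.
Proof.
pose T := pe @: [set~ r].
have cT : #|T|.+1 = #|vertex G|.
  rewrite card_in_imset; last exact: pe_inj.
  by rewrite cardsC1 prednK //; apply/card_gt0P; exists r.
have : #|[set e | crosses (desc v) e]| <= #|pe v |: ~: T|.
  apply/subset_leq_card/subsetP => e; rewrite !inE.
  case: (boolP (e \in T)); last by rewrite orbT.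
  case/imsetP => u; rewrite !inE => ur -> /(crosses_desc ur) ->.
  by rewrite eqxx.
have := cardsC T; rewrite cardsU1 -cT; case: (_ \notin _)  => /=; lia.
Qed.

Lemma desc_children v : desc v \subset v |: \bigcup_(c in children v) desc c.
Proof.
apply/subsetP => u; rewrite inE => /iter_findex.
move: (findex parent u v) => k; elim: k u => [u /= ->|k IH u]; first by rewrite setU11.
rewrite iterSr => /IH; rewrite !inE => /orP[/eqP pv|].
  have [ur|ur] := eqVneq u r.
    by move: pv; rewrite /parent ur eqxx => ->; rewrite eqxx.
  apply/orP; right; apply/bigcupP; exists u; first by rewrite inE ur pv eqxx.
  by rewrite inE connect0.
case/bigcupP => c cv; rewrite inE => pc; apply/orP; right.
apply/bigcupP; exists c => //; rewrite inE.
exact: connect_trans (fconnect1 _ _) pc.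
Qed.

(** The parent edges of the children of [v], together with that of [v] itself
    when [v] is not the root, are distinct and incident to [v]. *)
Lemma card_children v : #|children v| + (v != r) <= deg v.
Proof.
apply: leq_trans (card_incident v).
have vC : v \notin children v.
  rewrite inE; apply/negP => /andP[vr /eqP pv].
  by have := ltn_parent vr; rewrite pv ltnn.
pose S := children v :|: (if v == r then set0 else [set v]).
have Sr : S \subset [set~ r].
  apply/subsetP => u; rewrite !inE => /orP[/andP[]//|].
  by case: (eqVneq v r) => [|vr]; rewrite !inE // => /eqP ->.
have <- : #|pe @: S| = #|children v| + (v != r).
  rewrite card_in_imset; last first.
    by move=> x y xS yS; apply: pe_inj; apply: (subsetP Sr).
  rewrite /S; case: eqP => _ /=; first by rewrite setU0 addn0.
  by rewrite setUC cardsU1 vC addnC.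
apply/subset_leq_card/subsetP => _ /imsetP[u uS ->]; rewrite inE.
have ur : u != r by have := subsetP Sr u uS; rewrite !inE.
have /andP[iu _] := peP ur.
move: uS; rewrite !inE => /orP[/andP[_]|].
  rewrite /parent (negPf ur) /incident /opp_end => /eqP <-.
  by case: ifP => _; rewrite eqxx ?orbT.
by case: (eqVneq v r) => vr; rewrite !inE // => /eqP <-.
Qed.

Lemma bdry_desc_le v :
  #|desc v :&: bdry G| <= (v \in bdry G) +
    \sum_(c in children v) #|desc c :&: bdry G|.
Proof.
have : #|desc v :&: bdry G| <=
    #|([set v] :&: bdry G) :|: \bigcup_(c in children v) (desc c :&: bdry G)|.
  apply/subset_leq_card; rewrite -big_distrl -setIUl setSI //=.
  exact: desc_children.
move/leq_trans; apply; apply: leq_trans (leq_card_setU _ _).1 _.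
apply: leq_add; last first.
  elim/big_rec2: _ => [|c k U _ Uk]; first by rewrite cards0.
  by apply: leq_trans (leq_card_setU _ _).1 _; rewrite leq_add2l.
rewrite setIC; case: (boolP (v \in bdry G)) => vB.
  by apply: leq_trans (subset_leq_card (subsetIr _ _)) _; rewrite cards1.
rewrite leqn0 cards_eq0; apply/eqP/setP => u; rewrite !inE andbC.
by case: eqP => [->|//]; rewrite (negPf vB).
Qed.

End Descendants.

(** Among the vertices with at least a third of the boundary below them, take
    one farthest from the root. Each of its children has less than a third
    below it, and an interior vertex has at most two children, so at most two
    thirds of the boundary lie below it. A boundary vertex other than the root
    has no children. The root is taken on the boundary, so that it has at most
    one child and cannot be chosen when there are two boundary vertices. *)
Lemma balanced_cut G : connected_graph G -> 2 <= #|bdry G| ->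
    (forall v : vertex G, deg v <= 3) ->
    (forall v : vertex G, v \in bdry G -> deg v <= 1) ->
  exists A : {set vertex G},
    [/\ #|[set e | crosses A e]| + #|vertex G| <= #|edge G| + 2,
        #|bdry G| <= 3 * #|A :&: bdry G|
      & #|bdry G| <= 3 * #|~: A :&: bdry G|].
Proof.
move=> cG n2 d3 d1.
have /card_gt1P[r [r' [rB _ rr']]] : 1 < #|bdry G| by [].
have [d dP] := dist_exists r cG.
have [e0 _] : exists e, incident e r' && (d (opp_end e r') < d r').
  by apply: dP; rewrite eq_sym.
have /fin_all_exists[pe peP] : forall v, exists e, v != r ->
    incident e v && (d (opp_end e v) < d v).
  move=> v; have [_|/dP[e he]] := eqVneq v r; first by exists e0.
  by exists e.
set D := desc r pe; set B := bdry G in n2 d1 rB *.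
have Pr : #|B| <= 3 * #|D r :&: B| by rewrite /D (desc_root peP) setTI; lia.
case: (@arg_maxnP _ r (fun v => #|B| <= 3 * #|D v :&: B|) d Pr) => v Pv vmax.
exists (D v); split => //; first exact: (card_crosses_desc peP).
have small c : c \in children r pe v -> 3 * #|D c :&: B| < #|B|.
  rewrite inE => /andP[cr /eqP cv]; rewrite ltnNge; apply/negP => /vmax.
  by have := ltn_parent peP cr; rewrite cv /= => /leq_trans h /h; rewrite ltnn.
have Dv : 3 * #|D v :&: B| <= 3 * (v \in B) + #|children r pe v| * #|B|.-1.
  rewrite -sum_nat_const.
  apply: leq_trans (leq_mul (leqnn 3) (bdry_desc_le _ _ _)) _.
  rewrite mulnDr big_distrr leq_add2l /=; apply: leq_sum => c /small.
  by rewrite -/D -/B; lia.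
have : 3 * #|D v :&: B| <= 2 * #|B|.
  apply: leq_trans Dv _; have := card_children peP v.
  case: (boolP (v \in B)) => vB; last first.
    have -> /= : v != r by apply: contraNneq vB => ->.
    by have := d3 v; nia.
  by have := d1 v vB; case: eqP => _ /=; nia.
by have := cardsID (D v) B; rewrite setIC setDE (setIC B); lia.
Qed.

Local Open Scope ring_scope.

(** * Minimising the Rayleigh quotient *)

Section Rayleigh.
Variables (R : realType) (G : bgraph) (w : vertex G -> nat).
Local Notation fT := {ffun vertex G -> R^o}.
Implicit Types (f h : vertex G -> R) (v : vertex G).

Definition energy f : R := \sum_(e : edge G) (f (src e) - f (tgt e)) ^+ 2.

Definition mass f : R := \sum_v (w v)%:R * f v ^+ 2.

Definition mean f : R := \sum_v (w v)%:R * f v.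

Lemma energy_ge0 f : 0 <= energy f.
Proof. by apply: sumr_ge0 => e _; apply: sqr_ge0. Qed.

Lemma mass_ge0 f : 0 <= mass f.
Proof. by apply: sumr_ge0 => v _; rewrite mulr_ge0 ?ler0n ?sqr_ge0. Qed.

Definition clip (x : R) : R := Num.max (-1) (Num.min x 1).

Lemma clip_itv x : -1 <= clip x <= 1.
Proof. by rewrite le_max lexx ge_max ge_min lexx orbT andbT; lra. Qed.

Lemma clip_id x : x ^+ 2 <= 1 -> clip x = x.
Proof.
move=> hx; have h1 : x <= 1 by nra.
have h2 : -1 <= x by nra.
by rewrite /clip min_l // max_r.
Qed.

Lemma clip_contract x y : (clip x - clip y) ^+ 2 <= (x - y) ^+ 2.
Proof.
wlog xy : x y / x <= y => [H|].
  by case: (leP x y) => [|/ltW] /H //; rewrite -sqrrN opprB -(sqrrN (x - y)) opprB.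
have : 0 <= clip y - clip x <= y - x.
  rewrite /clip; case: (leP x 1) => ?; case: (leP y 1) => ?; rewrite /Num.max;
  by do ![case: ifPn; rewrite -?leNgt => ?]; apply/andP; split; lra.
by move=> /andP[? ?]; nra.
Qed.

(** After normalisation every vertex of positive weight has a value in
    [[-1, 1]], because weights are integers; clipping therefore preserves [mass]
    and [mean]. This confines a minimising sequence to a compact set even though
    [mass] does not control the vertices of weight [0]. *)
Lemma truncate f : mean f = 0 -> 0 < mass f ->
  exists h, [/\ forall v, -1 <= h v <= 1, mean h = 0, mass h = 1
    & energy h * mass f <= energy f].
Proof.
move=> mf Mf; pose c := (Num.sqrt (mass f))^-1; pose k v := c * f v.
have cc : c ^+ 2 * mass f = 1.
  by rewrite exprVn sqr_sqrtr ?mass_ge0 // mulVf ?gt_eqF.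
have Mk : mass k = 1.
  rewrite -cc mulr_sumr; apply: eq_bigr => v _; rewrite /k; ring.
have wk v : w v != 0%N -> clip (k v) = k v.
  move=> wv; apply: clip_id; rewrite -Mk /mass (bigD1 v) //=.
  apply: ler_wpDr; first by apply: sumr_ge0 => *; rewrite mulr_ge0 ?sqr_ge0.
  by rewrite ler_peMl ?sqr_ge0 // ler1n lt0n.
exists (clip \o k); split.
- by move=> v; apply: clip_itv.
- rewrite -[RHS](mulr0 c) -mf mulr_sumr; apply: eq_bigr => v _ /=.
  have [->|/wk ->] := eqVneq (w v) 0%N; first by rewrite !mul0r mulr0.
  by rewrite /k; ring.
- rewrite -Mk; apply: eq_bigr => v _ /=.
  by have [->|/wk ->] := eqVneq (w v) 0%N; rewrite ?mul0r.
have -> : energy f = energy k * mass f.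
  rewrite -[LHS]mulr1 -cc mulrCA mulrA; congr (_ * _).
  rewrite mulr_sumr; apply: eq_bigr => e _; rewrite /k; ring.
rewrite ler_pM2r //; apply: ler_sum => e _; exact: clip_contract.
Qed.

(** The cube [[-1, 1] ^ V] is compact, [mean] and [mass] cut out a closed part
    of it, and [truncate] brings every competitor into that part. *)
Lemma rayleigh_min : (exists2 f, mean f = 0 & 0 < mass f) ->
  exists h, [/\ mean h = 0, mass h = 1
    & forall f, mean f = 0 -> energy h * mass f <= energy f].
Proof.
case=> f0 /truncate/[apply] -[h0 [b0 m0 M0 _]].
pose Rt : topologicalType := R.
pose T : topologicalType := prod_topology (fun _ : vertex G => Rt).
have cX v : continuous (fun f : T => f v : R) by exact: (@proj_continuous _ (fun=> Rt) v).
have cS (I : finType) (F : I -> T -> R) :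
    (forall i, continuous (F i)) -> continuous (fun f : T => \sum_i F i f).
  by move=> cF; apply: continuous_big => //; exact: add_continuous.
have cQ (F : T -> R) : continuous F -> continuous (fun f : T => F f ^+ 2).
  by move=> cF f; exact: (continuousM (cF f) (cF f)).
have cZ (c : R) (F : T -> R) : continuous F -> continuous (fun f : T => c * F f).
  by move=> cF f; exact: (continuousM (@cst_continuous _ _ c f) (cF f)).
have cE : continuous (fun f : T => energy f).
  by apply: cS => e; apply: cQ => f; exact: (continuousB (cX _ f) (cX _ f)).
have cM : continuous (fun f : T => mass f).
  by apply: cS => v; apply: cZ; apply: cQ; exact: cX.
have cm : continuous (fun f : T => mean f).
  by apply: cS => v; apply: cZ; exact: cX.
pose B : set T := [set f : T | forall v, `[-1, 1]%classic (f v)]%classic.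
pose K : set T := (B `&` (((fun f : T => mean f) @^-1` [set 0]) `&`
                          ((fun f : T => mass f) @^-1` [set 1])))%classic.
have cl (F : T -> R) c : continuous F -> closed (F @^-1` [set c])%classic.
  by move=> cF; apply: preimage_closed => [x _|]; [exact: cF | exact: closed_eq].
have cK : compact K.
  apply: (@compact_closedI T B); last by apply: closedI; apply: cl.
  apply: (@tychonoff _ (fun=> Rt) (fun=> `[-1, 1]%classic)) => v.
  exact: segment_compact.
have [||h] := @compact_EVT_min T R (fun f : T => energy f) K _ cK.
- by exists h0; split => // v; rewrite /= in_itv.
- exact: continuous_subspaceT.
rewrite in_setE => -[_ [mh Mh]] hmin.
exists h; split => // f mf; have := mass_ge0 f; rewrite le_eqVlt => /orP[/eqP<-|].
  by rewrite mulr0 energy_ge0.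
move=> Mf; have [k [bk mk Mk Ek]] := truncate mf Mf; apply: le_trans Ek.
by rewrite ler_pM2r // hmin // in_setE; split => // v; rewrite /= in_itv.
Qed.
End Rayleigh.

Lemma sorted_second_le (R : realType) (s : seq R) (a : R) :
  sorted <=%R s -> 0 \in s -> a \in s -> 0 < a -> (1 < size s)%N /\ s`_1 <= a.
Proof.
case: s => [|x [|y t]] //=.
  by move=> _; rewrite !inE => /eqP <- /eqP ->; rewrite ltxx.
move=> /andP[xy yt]; have /allP ym := order_path_min le_trans yt.
have xm z : z \in y :: t -> x <= z.
  by rewrite inE => /orP[/eqP ->|/ym /(le_trans xy)].
rewrite !(in_cons x) => z0 ax a0; split=> //.
have {ax} : a \in y :: t.
  case/orP: ax => // /eqP ax; move: a0; rewrite ax.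
  case/orP: z0 => [/eqP <-|/xm]; first by rewrite ltxx.
  by move=> /le_lt_trans/[apply]; rewrite ltxx.
by rewrite inE => /orP[/eqP ->|/ym].
Qed.

(** * Eigenfunctions of a weighted problem *)

Section Variational.
Variables (R : realType) (G : bgraph) (w : vertex G -> nat).
Hypotheses (cG : connected_graph G) (w_neq0 : exists v, w v != 0%N).
Implicit Types (a : R) (f h : vertex G -> R) (v : vertex G).
Local Notation mass := (@mass R G w).
Local Notation mean := (@mean R G w).

(** The Laplacian without the factor [1 / deg v]. *)
Definition flux f v : R :=
  \sum_(e : edge G | src e == v) (f (tgt e) - f v)
  + \sum_(e : edge G | tgt e == v) (f (src e) - f v).

Definition eigenfun a f := forall v, - flux f v = a * ((w v)%:R * f v).

Lemma green_bilinear f h :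
  \sum_v h v * flux f v =
  - \sum_(e : edge G) (f (src e) - f (tgt e)) * (h (src e) - h (tgt e)).
Proof.
have E (r t : edge G -> vertex G) :
    \sum_v h v * \sum_(e | r e == v) (f (t e) - f v)
    = \sum_e h (r e) * (f (t e) - f (r e)).
  rewrite [RHS](partition_big r xpredT) //=; apply: eq_bigr => v _.
  by rewrite mulr_sumr; apply: eq_bigr => e /eqP ->.
under eq_bigr do rewrite mulrDr.
rewrite big_split /= !E -big_split -sumrN /=.
by apply: eq_bigr => e _; ring.
Qed.

Lemma energy_eq0 f : energy f = 0 -> forall u v, f u = f v.
Proof.
move=> Ef u v.
have := @energy_const R G [ffun x => f x] cG; rewrite /= => H.
have {H} := H _ u v; rewrite !ffunE; apply.
by rewrite -[RHS]Ef; apply: eq_bigr => e _; rewrite !ffunE.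
Qed.

Lemma sum_weight_gt0 : 0 < \sum_v (w v)%:R :> R.
Proof.
have [v wv] := w_neq0; rewrite (bigD1 v) //=.
by rewrite ltr_wpDr ?ltr0n ?lt0n // sumr_ge0.
Qed.

Lemma mass_cst c : mass (fun=> c) = (\sum_v (w v)%:R) * c ^+ 2.
Proof. by rewrite mulr_suml. Qed.

Lemma mean_cst c : mean (fun=> c) = (\sum_v (w v)%:R) * c.
Proof. by rewrite mulr_suml. Qed.

Lemma mass_eq0 f : energy f = 0 -> mass f = 0 -> forall v, f v = 0.
Proof.
move=> /energy_eq0 fc Mf v.
have : mass f = mass (fun=> f v) by rewrite /mass; apply: eq_bigr => u _; rewrite (fc u v).
rewrite Mf mass_cst => /esym/eqP; rewrite mulf_eq0 gt_eqF ?sum_weight_gt0 //=.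
by rewrite sqrf_eq0 => /eqP.
Qed.

Lemma eigenfun_energy a f : eigenfun a f -> energy f = a * mass f.
Proof.
move=> ef; have /eqP := green_bilinear f f; rewrite eq_sym eqr_oppLR => /eqP E.
rewrite /energy (eq_bigr _ (fun e _ => expr2 _)) E -sumrN mulr_sumr.
by apply: eq_bigr => v _; rewrite -mulrN ef; ring.
Qed.

Lemma eigenfun_mean a f : eigenfun a f -> a * mean f = 0.
Proof.
move=> ef; have := green_bilinear f (fun=> 1).
rewrite [in RHS]big1 ?oppr0 => [E|e _]; last by rewrite subrr mulr0.
rewrite -[RHS]oppr0 -[X in - X]E mulr_sumr -sumrN.
by apply: eq_bigr => v _; rewrite -ef mul1r.
Qed.

Lemma eigenfun_mass a f : eigenfun a f -> (exists v, f v != 0) -> 0 < mass f.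
Proof.
move=> ef [v fv]; rewrite lt0r mass_ge0 andbT; apply: contraNneq fv => Mf.
by rewrite mass_eq0 // (eigenfun_energy ef) Mf mulr0.
Qed.

(** At [t = - b / (|c| + 1)] the linear term dominates unless [b = 0]. *)
Lemma linear_term_eq0 (b c : R) : (forall t, 0 <= 2 * t * b + t ^+ 2 * c) -> b = 0.
Proof.
move=> H; apply/eqP; apply: contraT => b0.
pose k := `|c| + 1.
have k0 : 0 < k by rewrite ltr_wpDl.
have := H (- b / k).
have -> : 2 * (- b / k) * b + (- b / k) ^+ 2 * c = (b / k) ^+ 2 * (c - 2 * k).
  by field; rewrite gt_eqF.
rewrite pmulr_rge0; last first.
  by rewrite exprn_even_gt0 //= mulf_neq0 // invr_eq0 gt_eqF.
have : c - 2 * k < 0 by have := ler_norm c; have := normr_ge0 c; rewrite /k; lra.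
by rewrite ltNge => /negPf ->.
Qed.

(** The minimiser of the Rayleigh quotient satisfies the Euler-Lagrange
    equation: the quadratic form [energy - a * mass] is nonnegative on functions
    of mean [0] and vanishes at [h], so [h] is orthogonal to these functions for
    the polar form, and to the constants because [mean h = 0]. Testing against
    the indicators of single vertices gives the eigenvalue equation. *)
Lemma rayleigh_eigenfun : (exists2 f, mean f = 0 & 0 < mass f) ->
  exists a h, [/\ 0 < a, eigenfun a h, exists v, h v != 0
    & forall f, mean f = 0 -> a * mass f <= energy f].
Proof.
move=> /rayleigh_min[h [mh Mh hmin]]; exists (energy h), h.
have hn0 : exists v, h v != 0.
  apply/existsP; apply: contraT; rewrite negb_exists => /forallP h0.
  have := oner_neq0 R; rewrite -Mh /mass big1 ?eqxx // => v _.
  by have := h0 v; rewrite negbK => /eqP ->; rewrite expr0n mulr0.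
split=> //.
  rewrite lt0r energy_ge0 andbT; apply: contraTneq isT => /energy_eq0 hc.
  have [v] := hn0; have : mean h = mean (fun=> h v).
    by apply: eq_bigr => u _; rewrite (hc u v).
  rewrite mh mean_cst => /esym/eqP.
  by rewrite mulf_eq0 gt_eqF ?sum_weight_gt0 //= => ->.
set a := energy h in hmin *.
pose b f := \sum_(e : edge G) (h (src e) - h (tgt e)) * (f (src e) - f (tgt e))
             - a * \sum_v (w v)%:R * (h v * f v).
(* [b f] is half the derivative of [energy - a * mass] at [h] along [f]. *)
have b_mean0 f : mean f = 0 -> b f = 0.
  move=> mf; apply: (@linear_term_eq0 _ (energy f - a * mass f)) => t.
  have : a * mass (fun v => h v + t * f v) <= energy (fun v => h v + t * f v).
    apply: hmin; rewrite -[RHS]addr0 -[X in X + _]mh.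
    rewrite -[X in _ + X](mulr0 t) -[X in _ * X]mf mulr_sumr.
    by rewrite -big_split; apply: eq_bigr => v _ /=; ring.
  rewrite -subr_ge0.
  have -> : mass (fun v => h v + t * f v) =
      1 + 2 * t * (\sum_v (w v)%:R * (h v * f v)) + t ^+ 2 * mass f.
    rewrite -[X in _ = X + _ + _]Mh /mass !mulr_sumr -!big_split; apply: eq_bigr => v _ /=; ring.
  have -> : energy (fun v => h v + t * f v) = a + 2 * t *
      (\sum_(e : edge G) (h (src e) - h (tgt e)) * (f (src e) - f (tgt e)))
      + t ^+ 2 * energy f.
    rewrite /a /energy !mulr_sumr -!big_split; apply: eq_bigr => e _ /=; ring.
  by rewrite /b; congr (0 <= _); ring.
have b0 f : b f = 0.
  (* Subtracting the mean of [f] does not change [b f]. *)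
  pose c := mean f / \sum_v (w v)%:R.
  rewrite -(b_mean0 (fun v => f v - c)).
    rewrite /b; congr (_ - a * _); first by apply: eq_bigr => e _; ring.
    rewrite -[LHS]subr0 -[X in _ - X](mulr0 c) -[X in _ * X]mh mulr_sumr -sumrB.
    by apply: eq_bigr => v _; ring.
  have -> : mean (fun v => f v - c) = mean f - mean (fun=> c).
    by rewrite -sumrB; apply: eq_bigr => v _; ring.
  by rewrite mean_cst mulrC divfK ?subrr // gt_eqF ?sum_weight_gt0.
move=> v; pose g u : R := (u == v)%:R.
have /eqP := b0 g; rewrite /b -[X in X - _]opprK -green_bilinear subr_eq0.
have pick F : \sum_u g u * F u = F v.
  rewrite (bigD1 v) //= big1 => [|u /negPf uv]; rewrite /g ?eqxx ?mul1r ?addr0 //.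
  by rewrite uv mul0r.
rewrite pick => /eqP ->; congr (a * _).
by rewrite -(pick (fun u => (w u)%:R * h u)); apply: eq_bigr => u _; ring.
Qed.

(** The family of eigenspaces [S] and its sorted list [s] are kept abstract, so
    that the Laplace and the Steklov spectrum are two instances. *)
Section SecondEigenvalue.
Local Notation fT := {ffun vertex G -> R^o}.
Variables (S : R -> {vspace fT}) (s : seq R).
Hypothesis memS : forall a (f : fT), reflect (eigenfun a f) (f \in S a).
Hypothesis sP : lists_spectrum (fun a => \dim (S a)) s.

Lemma mem_spectrum a : reflect (exists2 f, eigenfun a f & exists v, f v != 0) (a \in s).
Proof.
have -> : (a \in s) = (S a != 0%VS).
  by rewrite -has_pred1 has_count (proj2 sP) lt0n dimv_eq0.
apply: (iffP idP) => [|[f ef [v fv]]].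
  rewrite -vpick0 => f0; exists (vpick (S a)); first by apply/memS/memv_pick.
  apply/existsP; apply: contraR f0; rewrite negb_exists => /forallP h0.
  by apply/eqP/ffunP => v; rewrite ffunE; apply/eqP; have := h0 v; rewrite negbK.
apply: contraNneq fv => S0.
have : [ffun x => f x] \in S a.
  apply/memS => u; rewrite ffunE -ef /flux.
  by congr (- (_ + _)); apply: eq_bigr => e _; rewrite !ffunE.
by rewrite S0 memv0 => /eqP /ffunP /(_ v); rewrite !ffunE => ->.
Qed.

Lemma spectrum_ge0 a : a \in s -> 0 <= a.
Proof.
case/mem_spectrum => f ef fn0; have := eigenfun_mass ef fn0.
by have := energy_ge0 f; rewrite (eigenfun_energy ef) => + M; rewrite pmulr_lge0.
Qed.

Lemma eigenfun_cst : eigenfun 0 (fun=> 1).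
Proof.
by move=> v; rewrite /flux !big1 ?mul0r ?addr0 ?oppr0 // => e _; rewrite subrr.
Qed.

Lemma zero_in_spectrum : 0 \in s.
Proof.
apply/mem_spectrum; exists (fun=> 1); first exact: eigenfun_cst.
by have [v _] := w_neq0; exists v; rewrite oner_neq0.
Qed.

(** An eigenfunction for [0] has energy [0], hence is constant. *)
Lemma count_zero_spectrum : (count_mem 0%R s <= 1)%N.
Proof.
have [_ ->] := sP; have [v0 _] := w_neq0.
suff /dimvS/leq_trans : (S 0 <= <[[ffun=> 1] : fT]>)%VS.
  by apply; rewrite dim_vline; case: (_ != _).
apply/subvP => f /memS /eigenfun_energy; rewrite mul0r => /energy_eq0 fc.
apply/vlineP; exists (f v0); apply/ffunP => v.
by rewrite !ffunE [RHS]mulr1 (fc v v0).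
Qed.

(** The size bound ensures that index [1] of the list is a true entry and not
    the default value [0]. *)
Lemma second_eigenvalue_le f : mean f = 0 -> 0 < mass f ->
  (1 < size s)%N /\ s`_1 * mass f <= energy f.
Proof.
move=> mf Mf; have [|a [h [a0 eh hn0 amin]]] := rayleigh_eigenfun; first by exists f.
have ains : a \in s by apply/mem_spectrum; exists h.
have [sz sa] := sorted_second_le (proj1 sP) zero_in_spectrum ains a0.
by split=> //; apply: le_trans (amin f mf); rewrite ler_pM2r.
Qed.

Lemma second_eigenvalue_attained : (exists2 f, mean f = 0 & 0 < mass f) ->
  exists f, [/\ mean f = 0, 0 < mass f & energy f = s`_1 * mass f].
Proof.
case=> f0 mf0 /(second_eigenvalue_le mf0)[sz _] {f0 mf0}.
have s1 : s`_1 \in s by apply: mem_nth.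
have s1_gt0 : 0 < s`_1.
  rewrite lt0r spectrum_ge0 // andbT; apply: contraTneq count_zero_spectrum => z.
  move: z (proj1 sP) spectrum_ge0; move: sz; clear.
  case: s => [|x [|y t]] //= _ -> /andP[x0 _] xge0.
  have -> : x = 0 by apply/eqP; rewrite eq_le x0 xge0 ?mem_head.
  by rewrite !eqxx.
have [f ef fn0] := mem_spectrum _ s1; exists f; split.
- by apply/eqP; have/eqP := eigenfun_mean ef; rewrite mulf_eq0 gt_eqF.
- exact: eigenfun_mass ef fn0.
- exact: eigenfun_energy.
Qed.

End SecondEigenvalue.
End Variational.

(** * The cut as a test function, and the two spectra *)

Lemma natr_card (R : pzSemiRingType) (T : finType) (A : {set T}) :
  #|A|%:R = \sum_v (v \in A)%:R :> R.
Proof. by rewrite -sum1_card natr_sum [LHS]big_mkcond; apply: eq_bigr => v _; case: ifP. Qed.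

Definition bdry_weight (G : bgraph) (v : vertex G) : nat := v \in bdry G.
Arguments bdry_weight G v : clear implicits.

Section CutTestFunction.
Variables (R : realType) (G : bgraph) (A : {set vertex G}).
Let a : R := #|A :&: bdry G|%:R.
Let b : R := #|~: A :&: bdry G|%:R.

Definition cut_fun (v : vertex G) : R := if v \in A then b else - a.

Lemma sum_bdry_weight_cut (x y : R) :
  \sum_v (bdry_weight G v)%:R * (if v \in A then x else y) = a * x + b * y.
Proof.
rewrite /a /b !natr_card !mulr_suml -big_split; apply: eq_bigr => v _ /=.
by rewrite /bdry_weight !inE; case: (v \in A); rewrite ?mul0r ?addr0 ?add0r.
Qed.

Lemma mean_cut_fun : mean (bdry_weight G) cut_fun = 0.
Proof. by rewrite /mean sum_bdry_weight_cut; ring. Qed.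

Lemma mass_cut_fun : mass (bdry_weight G) cut_fun = a * b * (a + b).
Proof.
rewrite /mass; under eq_bigr do rewrite /cut_fun (fun_if (fun x => x ^+ 2)).
by rewrite sum_bdry_weight_cut; ring.
Qed.

Lemma energy_cut_fun :
  energy cut_fun = #|[set e | crosses A e]|%:R * (a + b) ^+ 2.
Proof.
rewrite natr_card mulr_suml; apply: eq_bigr => e _; rewrite inE /crosses /cut_fun.
by case: (src e \in A); case: (tgt e \in A) => /=; ring.
Qed.
End CutTestFunction.

Section Spectra.
Variables (R : realType) (G : bgraph).
Local Notation fT := {ffun vertex G -> R^o}.

Lemma laplaceP (a : R) (f : fT) : (forall v : vertex G, 0 < deg v)%N ->
  reflect (eigenfun (@deg G) a f) (f \in passmx.leigenspace (- linfun (@laplacian R G)) a).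
Proof.
move=> dG; apply: (iffP (mem_laplace_space _ _)) => H v.
  by have := deg_laplacian f (dG v); rewrite -/(flux f v) => <-; rewrite -mulrN H mulrCA.
have dv : (deg v)%:R != 0 :> R by rewrite pnatr_eq0 -lt0n.
apply: (mulfI dv); rewrite mulrN (deg_laplacian f (dG v)) -/(flux f v) H.
by rewrite mulrCA.
Qed.

Lemma steklovP (a : R) (f : fT) : (forall v : vertex G, 0 < deg v)%N ->
  (forall v : vertex G, v \in bdry G -> deg v = 1%N) ->
  reflect (eigenfun (bdry_weight G) a f) (f \in steklov_space G a).
Proof.
move=> dG d1; apply: (iffP (mem_steklov_space _ _)) => [[Hi Hb] v|H].
  rewrite /bdry_weight; case: (boolP (v \in bdry G)) => vB.
    by rewrite mul1r -Hb // deg1_normal_deriv ?d1.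
  have := deg_laplacian f (dG v); rewrite -/(flux f v) => <-.
  by rewrite Hi // mul0r !mulr0 oppr0.
split=> v vB; have := H v; rewrite /bdry_weight.
  rewrite (negPf vB) mul0r mulr0 => /eqP; rewrite oppr_eq0 => /eqP.
  have := deg_laplacian f (dG v); rewrite -/(flux f v) => <- /eqP.
  by rewrite mulf_eq0 pnatr_eq0 eqn0Ngt dG => /eqP.
by rewrite vB mul1r deg1_normal_deriv ?d1.
Qed.
End Spectra.

Theorem theorem1p2 (R : realType) (g n : nat) (hn : (2 <= n)%N)
    (hgn : (2 < 2 * g + n)%N) (G : bgraph) (hG : in_F g n G) :
  (laplace_spectrum R G)`_1 <= (steklov_spectrum R G)`_1
    <= 16%:R * (g + 1)%:R / (3%:R * n%:R).
Proof.
have [cG nI nB d3 d1] := hG.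
have dG (v : vertex G) : (0 < deg v)%N.
  by case: (boolP (v \in bdry G)) => [/d1|/d3] ->.
have /card_gt0P[v0 v0B] : (0 < #|bdry G|)%N by rewrite nB; lia.
have nV : #|vertex G| = (2 * g + n - 2 + n)%N.
  by rewrite -(cardsC (bdry G)) nB nI; lia.
have nE : (2 * #|edge G| = 3 * (2 * g + n - 2) + n)%N.
  rewrite -handshake (bigID (mem (bdry G))) /= (eq_bigr _ d1) (eq_bigr _ d3).
  rewrite !sum_nat_const nB -nI; have -> : #|[predC bdry G]| = #|~: bdry G|.
    by apply: eq_card => v; rewrite !inE.
  lia.
have wS : exists v : vertex G, bdry_weight G v != 0%N by exists v0; rewrite /bdry_weight v0B.
have wL : exists v : vertex G, deg v != 0%N by exists v0; rewrite -lt0n.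
have memL a f := @laplaceP R G a f dG.
have memS a f := @steklovP R G a f dG d1.
have sL := @laplace_spectrumP R G dG.
have sS : lists_spectrum (@steklov_mult R G) (steklov_spectrum R G).
  by apply: steklov_spectrumP => //; apply/set0Pn; exists v0.
have [A [kA aA bA]] : exists A : {set vertex G},
    [/\ (#|[set e | crosses A e]| <= g + 1)%N, (n <= 3 * #|A :&: bdry G|)%N
      & (n <= 3 * #|~: A :&: bdry G|)%N].
  have [|v|v /d1 -> //|A [kA aA bA]] := balanced_cut cG; first by rewrite nB.
    by case: (boolP (v \in bdry G)) => [/d1|/d3] ->.
  by exists A; rewrite -nB; split => //; lia.
have ab : (#|A :&: bdry G| + #|~: A :&: bdry G| = n)%N.
  by rewrite -nB -(cardsID A (bdry G)) setDE !(setIC (bdry G)).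
(* From here on [a] and [b] count the boundary vertices on the two sides. *)
set k := #|[set e | _]| in kA; set a := #|_| in aA ab; set b := #|_| in bA ab.
have a0 : (0 < a)%N by lia.
have b0 : (0 < b)%N by lia.
have mphi : mean (bdry_weight G) (cut_fun R A) = 0 by exact: mean_cut_fun.
have Mphi : 0 < mass (bdry_weight G) (cut_fun R A).
  by rewrite mass_cut_fun -natrD -!natrM ltr0n !muln_gt0 a0 b0 addn_gt0 a0.
apply/andP; split; last first.
  have [_] := second_eigenvalue_le cG wS memS sS mphi Mphi.
  rewrite mass_cut_fun energy_cut_fun -/a -/b -/k -natrD ab => H.
  set s := _`_1 in H *.
  have nn : 0 < n%:R :> R by rewrite ltr0n; lia.
  have abn : 0 < (a * b)%:R :> R by rewrite ltr0n muln_gt0 a0.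
  have {}H : s * (a * b)%:R <= (g + 1)%:R * n%:R.
    rewrite -(ler_pM2r nn) natrM -mulrA; apply: le_trans H _.
    by rewrite -mulrA -expr2 ler_pM2r ?exprn_gt0 // ler_nat.
  have ab3 : (3 * n ^ 2 <= 16 * (a * b))%N by rewrite -ab in aA bA *; nia.
  rewrite ler_pdivlMr; last by rewrite mulr_gt0 // ltr0n.
  rewrite -(ler_pM2r abn).
  apply: (@le_trans _ _ (3 * n%:R * ((g + 1)%:R * n%:R))).
    rewrite [leLHS](_ : _ = 3 * n%:R * (s * (a * b)%:R)); last by ring.
    by rewrite ler_pM2l // mulr_gt0.
  by rewrite -!natrM ler_nat; nia.
have [|f [mf Mf Ef]] := second_eigenvalue_attained cG wS memS sS.
  by exists (cut_fun R A).
set s := (steklov_spectrum R G)`_1 in Ef *.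
have s_ge0 : 0 <= s by have := energy_ge0 f; rewrite Ef pmulr_lge0.
pose W : R := \sum_(v : vertex G) (deg v)%:R.
pose c := mean (@deg G) f / W.
pose h v := f v - c.
have W0 : 0 < W := sum_weight_gt0 R wL.
have Eh : energy h = energy f by apply: eq_bigr => e _; rewrite /h; ring.
have mh : mean (@deg G) h = 0.
  have -> : mean (@deg G) h = mean (@deg G) f - mean (@deg G) (fun=> c).
    by rewrite -sumrB; apply: eq_bigr => v _; rewrite /h; ring.
  by rewrite mean_cst mulrC divfK ?subrr // gt_eqF.
(* The cross term of the boundary mass of [f - c] vanishes as [mean f = 0], and
   the boundary weight is dominated by the degree. *)
have Mh : mass (bdry_weight G) f <= mass (@deg G) h.
  apply: (@le_trans _ _ (mass (bdry_weight G) h)).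
    have -> : mass (bdry_weight G) h = mass (bdry_weight G) f
        + mass (bdry_weight G) (fun=> c) - 2 * c * mean (bdry_weight G) f.
      rewrite mulr_sumr -big_split -sumrB; apply: eq_bigr => v _ /=.
      by rewrite /h; ring.
    by rewrite mf mulr0 subr0 lerDl mass_ge0.
  apply: ler_sum => v _; rewrite ler_wpM2r ?sqr_ge0 // ler_nat /bdry_weight.
  by case: (v \in bdry G); rewrite // dG.
have Mh0 := lt_le_trans Mf Mh.
have [_] := second_eigenvalue_le cG wL memL sL mh Mh0.
rewrite Eh Ef => H; rewrite -(ler_pM2r Mh0); apply: le_trans H _.
exact: ler_wpM2l.
Qed.
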